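(* Let $m\ge1$ and let $\widetilde{\mathcal{Q}}$ be the extended quiver with even vertices $x_1,\ldots,x_m$, arrows $x_k\to x_{k+1}$ for $1\le k\le m-1$, odd vertices $\xi_1,\ldots,\xi_{m+1}$, and $2$-paths $(\xi_2\to x_1\to\xi_1)$ and, for $2\le k\le m$, $(\xi_{k-1}\to x_k\to\xi_k)$ and $(\xi_{k+1}\to x_k\to\xi_k)$. Let $A(\widetilde{\mathcal{Q}})\subset\mathbb{C}(x_1,\ldots,x_m)\otimes\Lambda[\xi_1,\ldots,\xi_{m+1}]$ be the associated cluster superalgebra. Let $F=\big((f_{i,j}),(\varphi_{i,j})\big)$ be a superfrieze of width $m$ with entries in $\mathbb{C}(x_1,\ldots,x_m)\otimes\Lambda[\xi_1,\ldots,\xi_{m+1}]$ such that $f_{0,k-1}=x_k$ for $1\le k\le m$ and $\varphi_{\frac12,k-\frac12}=\xi_k$ for $1\le k\le m+1$. Then every entry of $F$ belongs to $A(\widetilde{\mathcal{Q}})$; in other words, the algebra of the superfrieze is a subalgebra of the cluster superalgebra $A(\widetilde{\mathcal{Q}})$.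
   Context: $\Lambda[\xi_1,\ldots,\xi_{m+1}]$ is the Grassmann algebra (odd anticommuting generators). A superfrieze of width $m$ with entries in a supercommutative ring $\mathcal{R}=\mathcal{R}_0\oplus\mathcal{R}_1$ consists of even entries $f_{i,j}\in\mathcal{R}_0$ for $i,j\in\mathbb{Z}$ with $-2\le j-i\le m+1$, and odd entries $\varphi_{i,j}\in\mathcal{R}_1$ for $i\in\frac12\mathbb{Z}$, $j-i\in\mathbb{Z}$, $-1\le j-i\le m+1$, with boundary values $f_{i,i-2}=f_{i,i+m+1}=0$, $f_{i,i-1}=f_{i,i+m}=1$, $\varphi_{i,i-1}=\varphi_{i,i+m+1}=0$, such that for every ''elementary diamond'' (all of whose entries are defined) with $A=f_{i,j}$, $B=f_{i+1,j}$, $C=f_{i,j+1}$, $D=f_{i+1,j+1}$, $\Xi=\varphi_{i+\frac12,j+\frac12}$, $\Psi=\varphi_{i+1,j+1}$, $\Phi=\varphi_{i,j+1}$, $\Sigma=\varphi_{i+\frac12,j+\frac32}$ the frieze rule holds: $$AD-BC=1+\Sigma\Xi,\qquad B\Phi-A\Psi=\Xi,\qquad B\Sigma-D\Xi=\Psi.$$ (In the planar picture, $B$ is the top, $A$ left, $D$ right, $C$ bottom vertex of the diamond, $\Xi,\Psi$ its upper-left/upper-right odd edges and $\Phi,\Sigma$ its lower-left/lower-right odd edges.) The algebra of a superfrieze is the superalgebra generated by all its entries. Extended quiver, mutations and cluster superalgebra: the extended quiver consists of the quiver on even vertices, the odd vertices, and the multiset of $2$-paths $(\xi_i\to x_k\to\xi_j)$.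 Mutation $\mu_k$ at $x_k$: the underlying quiver mutates classically (for each path $x_i\to x_k\to x_j$ add $x_i\to x_j$, reverse arrows at $x_k$, cancel oriented $2$-cycles); for each $2$-path $(\xi_i\to x_k\to\xi_j)$ and each arrow $x_k\to x_\ell$ (original quiver, with multiplicity) add $(\xi_i\to x_\ell\to\xi_j)$; reverse each $2$-path through $x_k$; cancel pairwise $2$-paths $(\xi_i\to x_\ell\to\xi_j)$, $(\xi_j\to x_\ell\to\xi_i)$. A mutation is allowed if, in the result, for each even vertex $x_\ell$ the sets $I_\ell$ of start indices and $J_\ell$ of end indices of $2$-paths through $x_\ell$ are disjoint and every pair in $I_\ell\times J_\ell$ is joined by the same number of $2$-paths through $x_\ell$. The even cluster variable $y_k$ at $x_k$ is replaced by $y_k'$ with $y_ky_k'=\prod_{x_k\to x_j}y_j+\big(1+\sum_{(\xi_i\to x_k\to\xi_j)}\xi_i\xi_j\big)\prod_{x_i\to x_k}y_i$ (with multiplicities; empty products $=1$); odd variables never change. $A(\widetilde{\mathcal{Q}})$ is the superalgebra generated by $x_1,\ldots,x_m,\xi_1,\ldots,\xi_{m+1}$ and all even cluster variables obtained by finite sequences of allowed mutations starting from the initial seed.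
   Formalization: The superfrieze is also required to satisfy φ_{i,i} = φ_{i+1/2,i+1/2} for all integers i (the rule AΣ−CΞ=Φ on the top row); with only the three printed rules the claim fails, e.g. for m=1, where φ_{2,2} can be any odd element. *)

(* Defs.v *)
From HB Require Import structures.
From mathcomp Require Import all_boot all_order all_algebra.
From mathcomp Require Import ring fraction complex reals mpoly.

Set Implicit Arguments.
Unset Strict Implicit.
Unset Printing Implicit Defensive.

Import Order.TTheory GRing.Theory Num.Theory.

Local Open Scope ring_scope.

(* The Grassmann algebra K[xi_0, ..., xi_(n-1)]: the free K-module on the     *)
(* monomials xi_S, S a set of indices, where xi_S is the product of the xi_i, *)
(* i \in S, in increasing order.  An element is its family of coefficients.   *)

Definition grassmann (K : comNzRingType) (n : nat) : Type :=
  {ffun {set 'I_n} -> K}.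

HB.instance Definition _ (K : comNzRingType) (n : nat) :=
  GRing.Lmodule.copy (grassmann K n) {ffun {set 'I_n} -> K^o}.

Section Grassmann.
Variables (K : comNzRingType) (n : nat).
Implicit Types (u v w : grassmann K n) (S T I J : {set 'I_n}).

(* The number of transpositions needed to sort xi_I * xi_J.                   *)
Definition ginv I J : nat := \sum_(i in I) \sum_(j in J) (j < i)%N.

Definition gone : grassmann K n := [ffun S => (S == set0)%:R].

Definition gmul u v : grassmann K n :=
  [ffun S : {set 'I_n} => \sum_(I : {set 'I_n} | I \subset S)
     (-1) ^+ ginv I (S :\: I) * u I * v (S :\: I)].

Definition gxi (i : 'I_n) : grassmann K n := [ffun S => (S == [set i])%:R].

Lemma ginv0l J : ginv set0 J = 0%N.
Proof. by rewrite /ginv big_set0. Qed.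

Lemma ginv0r I : ginv I set0 = 0%N.
Proof. by rewrite /ginv big1 // => i _; rewrite big_set0. Qed.

Lemma ginvUl I T J :
  [disjoint I & T] -> ginv (I :|: T) J = (ginv I J + ginv T J)%N.
Proof. move=> d; rewrite /ginv -bigU //=.
by apply: eq_bigl => i; rewrite !inE. Qed.

Lemma ginvUr I T J :
  [disjoint T & J] -> ginv I (T :|: J) = (ginv I T + ginv I J)%N.
Proof.
move=> d; rewrite /ginv -big_split /=; apply: eq_bigr => i _.
by rewrite -bigU //=; apply: eq_bigl => j; rewrite !inE.
Qed.

Lemma gmul1 : left_id gone gmul.
Proof.
move=> v; apply/ffunP => S; rewrite ffunE (bigD1 set0) ?sub0set //= big1.
  by rewrite ffunE eqxx ginv0l setD0 expr0 !mul1r addr0.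
by move=> I /andP[_ /negPf nI]; rewrite ffunE nI mulr0 mul0r.
Qed.

Lemma gmulr1 : right_id gone gmul.
Proof.
move=> v; apply/ffunP => S; rewrite ffunE (bigD1 S) //= big1.
  by rewrite ffunE setDv eqxx ginv0r expr0 mul1r mulr1 addr0.
move=> I /andP[sIS nI]; rewrite [X in _ * X]ffunE.
suff /negPf -> : S :\: I != set0 by rewrite mulr0.
by apply: contra nI; rewrite setD_eq0 eqEsubset sIS.
Qed.

Lemma gmulDl : left_distributive gmul +%R.
Proof.
move=> u v w; apply/ffunP => S; rewrite !ffunE -big_split /=.
by apply: eq_bigr => I _; rewrite ffunE mulrDr mulrDl.
Qed.

Lemma gmulDr : right_distributive gmul +%R.
Proof.
move=> u v w; apply/ffunP => S; rewrite !ffunE -big_split /=.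
by apply: eq_bigr => I _; rewrite ffunE mulrDr.
Qed.

Lemma ginv_cocycle S T I : I \subset T -> T \subset S ->
  (ginv T (S :\: T) + ginv I (T :\: I) =
   ginv I (S :\: I) + ginv (T :\: I) (S :\: T))%N.
Proof.
move=> sIT sTS.
have e1 : T = I :|: (T :\: I).
  by rewrite setDE setUIr setUCr setIT; apply/esym/setUidPr.
have e2 : S :\: I = (T :\: I) :|: (S :\: T).
  apply/setP => x; rewrite !inE.
  have := subsetP sIT x; have := subsetP sTS x.
  by case: (x \in S); case: (x \in T); case: (x \in I) => //= h1 h2;
     rewrite ?h1 ?h2 //; move: (h1 isT) (h2 isT).
have d1 : [disjoint I & T :\: I].
  by rewrite -setI_eq0; apply/eqP/setP => x; rewrite !inE; case: (x \in I).
have d2 : [disjoint T :\: I & S :\: T].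
  rewrite -setI_eq0; apply/eqP/setP => x; rewrite !inE.
  by case: (x \in T); rewrite ?andbF.
have d3 : [disjoint I & S :\: T].
  rewrite -setI_eq0; apply/eqP/setP => x; rewrite !inE.
  by have := subsetP sIT x; case: (x \in I) => // /(_ isT) ->.
rewrite e2 (ginvUr _ d2) [in X in (X + _)%N = _]e1 (ginvUl _ d1).
by rewrite -e1 addnC addnA.
Qed.

Lemma gmulA : associative gmul.
Proof.
move=> u v w; apply/ffunP => S; rewrite !ffunE.
transitivity (\sum_(I : {set 'I_n} | I \subset S)
    \sum_(T : {set 'I_n} | (T \subset S) && (I \subset T))
     (-1) ^+ ginv T (S :\: T) * ((-1) ^+ ginv I (T :\: I) * u I * v (T :\: I))
       * w (S :\: T)); last first.
  rewrite (exchange_big_dep (fun T : {set 'I_n} => T \subset S)) /=; last first.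
    by move=> I T _ /andP[].
  apply: eq_bigr => T sTS; rewrite ffunE mulr_sumr mulr_suml.
  apply: eq_bigl => I; rewrite sTS /=; apply: andb_idl => sIT.
  exact: subset_trans sTS.
apply: eq_bigr => I sIS; rewrite ffunE mulr_sumr.
rewrite (reindex_onto (fun T : {set 'I_n} => T :\: I) (fun J => I :|: J)) /=;
  last first.
  move=> J /subsetDP[_ dJI]; rewrite setDUl setDv set0U.
  by apply/setDidPl.
apply: eq_big => [T|T /andP[sT /eqP eT]].
  apply/andP/andP => [[s /eqP e]|[sTS sIT]].
    split; last by rewrite -e subsetUl.
    by rewrite -e subUset sIS; apply: subset_trans s (subsetDl _ _).
  split; first exact: setSD.
  by rewrite setDE setUIr setUCr setIT; apply/eqP/setUidPr.
have sIT : I \subset T by rewrite -eT subsetUl.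
have sTS : T \subset S.
  by rewrite -eT subUset sIS; apply: subset_trans sT (subsetDl _ _).
have -> : S :\: I :\: (T :\: I) = S :\: T by rewrite setDDl eT.
set a := _ ^+ _; set b := _ ^+ _; set c := _ ^+ _; set d := _ ^+ _.
have E : a * b = c * d by rewrite -!exprD -(ginv_cocycle sIT sTS).
transitivity ((a * b) * (u I * v (T :\: I) * w (S :\: T))); first by ring.
by rewrite E; ring.
Qed.

Lemma gone_neq0 : gone != 0.
Proof.
by apply/eqP => /ffunP /(_ set0); rewrite !ffunE eqxx => /eqP; rewrite oner_eq0.
Qed.

HB.instance Definition _ := GRing.Zmodule_isNzRing.Build (grassmann K n)
  gmulA gmul1 gmulr1 gmulDl gmulDr gone_neq0.

Definition geven u : Prop := forall S, odd #|S| -> u S = 0.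
Definition godd u : Prop := forall S, ~~ odd #|S| -> u S = 0.

Lemma gxiM i j :
  gxi i * gxi j = [ffun S => if (i != j) && (S == [set i; j])
                             then (-1) ^+ (j < i)%N else 0].
Proof.
apply/ffunP => S; rewrite !ffunE.
have gE (k : 'I_n) T : gxi k T = (T == [set k])%:R by rewrite ffunE.
case: (boolP (i \in S)) => iS; last first.
  rewrite big1.
    by rewrite ifF //; apply: contraNF iS => /andP[_ /eqP ->]; rewrite set21.
  move=> I sIS; rewrite !gE; case: eqP => [eI|_]; last by rewrite mulr0 mul0r.
  by move: sIS; rewrite eI sub1set (negPf iS).
rewrite (bigD1 [set i]) ?sub1set //= big1 ?addr0; last first.
  by move=> I /andP[_ /negPf nI]; rewrite !gE nI mulr0 mul0r.
rewrite !gE eqxx mulr1; case: (eqVneq (S :\ i) [set j]) => [eS|nS].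
  have nij : i != j.
    by apply/eqP => e; move/setP/(_ i): eS; rewrite !inE e eqxx.
  have -> : S = [set i; j] by rewrite -(setD1K iS) eS.
  by rewrite nij eqxx setU1K ?inE // mulr1 /ginv !big_set1.
rewrite mulr0 ifF //; apply: contraNF nS => /andP[nij /eqP ->].
by rewrite setU1K // inE.
Qed.

Lemma gxi_anticomm i j : gxi j * gxi i = - (gxi i * gxi j).
Proof.
rewrite !gxiM; apply/ffunP => S; rewrite !ffunE eq_sym setUC.
case: (eqVneq i j) => [//|nij] /=; first by rewrite oppr0.
case: eqP => _; last by rewrite oppr0.
by case: ltngtP nij => [_|_|/val_inj ->] //=; rewrite ?opprK // eqxx.
Qed.

Lemma gxi_sqr i : gxi i * gxi i = 0.
Proof. by rewrite gxiM; apply/ffunP => S; rewrite !ffunE eqxx. Qed.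

Lemma gscalerAl (a : K) u v : a *: (u * v) = (a *: u) * v.
Proof.
apply/ffunP => S; rewrite !ffunE scaler_sumr; apply: eq_bigr => I _.
by rewrite ffunE /GRing.scale /=; ring.
Qed.

HB.instance Definition _ :=
  GRing.Lmodule_isLalgebra.Build K (grassmann K n) gscalerAl.

Lemma gscalerAr (a : K) u v : a *: (u * v) = u * (a *: v).
Proof.
apply/ffunP => S; rewrite !ffunE scaler_sumr; apply: eq_bigr => I _.
by rewrite ffunE /GRing.scale /=; ring.
Qed.

HB.instance Definition _ :=
  GRing.Lalgebra_isAlgebra.Build K (grassmann K n) gscalerAr.

End Grassmann.

(* An extended quiver with m even and n odd vertices: arr i j is the number   *)
(* of arrows x_i -> x_j, tpath i l j the number of 2-paths                    *)
(* xi_i -> x_l -> xi_j.                                                       *)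

Record ext_quiver (m n : nat) := ExtQuiver {
  arr : 'I_m -> 'I_m -> nat;
  tpath : 'I_n -> 'I_m -> 'I_n -> nat
}.

Section Mutation.
Variables m n : nat.
Implicit Types (Q : ext_quiver m n) (k l : 'I_m).

(* In both definitions: add, reverse at k, then cancel; the last step is the  *)
(* truncated subtraction of nat.                                              *)
Definition mut_arr k Q (i j : 'I_m) : nat :=
  let added i j := (arr Q i j + arr Q i k * arr Q k j)%N in
  let reversed i j :=
    if (i == k) || (j == k) then arr Q j i else added i j in
  (reversed i j - reversed j i)%N.

Definition mut_tpath k Q (i : 'I_n) l (j : 'I_n) : nat :=
  let added i l j := (tpath Q i l j + tpath Q i k j * arr Q k l)%N in
  let reversed i l j := if l == k then tpath Q j l i else added i l j in
  (reversed i l j - reversed j l i)%N.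

Definition mutate k Q : ext_quiver m n :=
  ExtQuiver (mut_arr k Q) (mut_tpath k Q).

Definition starts Q l : {set 'I_n} :=
  [set i | [exists j, (0 < tpath Q i l j)%N]].
Definition ends Q l : {set 'I_n} :=
  [set j | [exists i, (0 < tpath Q i l j)%N]].

Definition admissible Q : Prop :=
  forall l, [disjoint starts Q l & ends Q l] /\
    exists N : nat, forall i j,
      i \in starts Q l -> j \in ends Q l -> tpath Q i l j = N.

Definition allowed k Q : Prop := admissible (mutate k Q).

End Mutation.

(* The subalgebra generated by G, the scalars acting through iota.            *)
Inductive generated (C A : pzRingType) (iota : C -> A) (G : A -> Prop) :
    A -> Prop :=
| gen_scalar c : generated iota G (iota c)
| gen_incl a : G a -> generated iota G a
| gen_add a b : generated iota G a -> generated iota G b ->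
    generated iota G (a + b)
| gen_mul a b : generated iota G a -> generated iota G b ->
    generated iota G (a * b).

(* C(x_1, ..., x_m), where C is the field R[i] of complex numbers.            *)
Definition ratfun (R : realType) (m : nat) : fieldType :=
  {fraction {mpoly R[i][m]}}.

(* C(x_1, ..., x_m) (x) Lambda[xi_1, ..., xi_n], as the Grassmann algebra     *)
(* over the field C(x_1, ..., x_m).                                           *)
Definition superring (R : realType) (m n : nat) : algType (ratfun R m) :=
  grassmann (ratfun R m) n.

Definition superring_even (R : realType) (m n : nat) :
  superring R m n -> Prop := @geven (ratfun R m) n.
Definition superring_odd (R : realType) (m n : nat) :
  superring R m n -> Prop := @godd (ratfun R m) n.

Section ClusterSuperalgebra.
Variables (R : realType) (m n : nat).
Local Notation A := (superring R m n).

Definition cst (c : R[i]) : A := (tofrac c%:MP_[m] : ratfun R m)%:A.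
Definition evar (k : 'I_m) : A :=
  (tofrac ('X_k : {mpoly R[i][m]}) : ratfun R m)%:A.
Definition ovar (i : 'I_n) : A := gxi (ratfun R m) i.

Definition exchange_rhs (Q : ext_quiver m n) (y : 'I_m -> A) (k : 'I_m) : A :=
  \prod_j y j ^+ arr Q k j
  + (1 + \sum_i \sum_j (ovar i * ovar j) *+ tpath Q i k j)
    * \prod_i y i ^+ arr Q i k.

(* y' is unique: modulo the xi_i the y k are the classical cluster variables, *)
(* which are nonzero rational functions, so the y k are invertible.           *)
Inductive reachable (Q0 : ext_quiver m n) :
    ext_quiver m n -> ('I_m -> A) -> Prop :=
| reach_init : reachable Q0 Q0 evar
| reach_mut Q y k (y' : A) :
    reachable Q0 Q y -> allowed k Q -> y k * y' = exchange_rhs Q y k ->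
    reachable Q0 (mutate k Q) (fun l => if l == k then y' else y l).

Inductive cluster_gen (Q0 : ext_quiver m n) : A -> Prop :=
| cg_odd i : cluster_gen Q0 (ovar i)
| cg_even Q y k : reachable Q0 Q y -> cluster_gen Q0 (y k).

Definition cluster_superalgebra (Q0 : ext_quiver m n) : A -> Prop :=
  generated cst (cluster_gen Q0).

End ClusterSuperalgebra.

(* The vertices are numbered from 0 (x_k is 'X_(k-1), and so on), so that     *)
(* xi_2 -> x_1 -> xi_1 also has the form xi_(k+1) -> x_k -> xi_k.             *)
Definition Qtilde (m : nat) : ext_quiver m m.+1 := {|
  arr := fun i j => nat_of_bool (j == i.+1 :> nat);
  tpath := fun i l j =>
    nat_of_bool ((j == l :> nat) && ((i.+1 == l :> nat) || (i == l.+1 :> nat)))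
|}.

(* The odd entry phi_(a/2, b/2) is phi a b, with a = b modulo 2.  The values  *)
(* of f and phi outside fdom and phidom are irrelevant.                       *)
Definition fdom (m : nat) (i j : int) : bool :=
  (- 2 <= j - i) && (j - i <= m.+1%:Z).
Definition phidom (m : nat) (a b : int) : bool :=
  [&& (2 %| b - a)%Z, - 2 <= b - a & b - a <= 2 * m.+1%:Z].

Section Superfrieze.
Variables (A : pzRingType) (even odd : A -> Prop) (m : nat).
Variables f phi : int -> int -> A.

Definition diamond (i j : int) : bool :=
  [&& fdom m i j, fdom m (i + 1) j, fdom m i (j + 1), fdom m (i + 1) (j + 1),
      phidom m (2 * i + 1) (2 * j + 1), phidom m (2 * i + 2) (2 * j + 2),
      phidom m (2 * i) (2 * j + 2) & phidom m (2 * i + 1) (2 * j + 3)].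

Definition frieze_rule (i j : int) : Prop :=
  let a := f i j in
  let b := f (i + 1) j in
  let c := f i (j + 1) in
  let d := f (i + 1) (j + 1) in
  let Xi := phi (2 * i + 1) (2 * j + 1) in
  let Psi := phi (2 * i + 2) (2 * j + 2) in
  let Phi := phi (2 * i) (2 * j + 2) in
  let Sigma := phi (2 * i + 1) (2 * j + 3) in
  [/\ a * d - b * c = 1 + Sigma * Xi,
      b * Phi - a * Psi = Xi
    & b * Sigma - d * Xi = Psi].

(* sf_top: given the first frieze rule, the last two are equivalent, whenever *)
(* b is invertible, to a * Sigma - c * Xi = Phi and d * Phi - c * Psi = Sigma. *)
(* On the top row of diamonds, j = i - 1, where b = 0, the former are void    *)
(* and the latter say Phi = Sigma.  Without this identity a superfrieze is    *)
(* not determined by its initial diagonal.                                    *)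
Record superfrieze : Prop := Superfrieze {
  sf_even i j : fdom m i j -> even (f i j);
  sf_odd a b : phidom m a b -> odd (phi a b);
  sf_f_top0 i : f i (i - 2) = 0;
  sf_f_top1 i : f i (i - 1) = 1;
  sf_f_bot1 i : f i (i + m%:Z) = 1;
  sf_f_bot0 i : f i (i + m.+1%:Z) = 0;
  sf_phi_top0 a : phi a (a - 2) = 0;
  sf_phi_bot0 a : phi a (a + 2 * m.+1%:Z) = 0;
  sf_rule i j : diamond i j -> frieze_rule i j;
  sf_top i : phi (2 * i) (2 * i) = phi (2 * i + 1) (2 * i + 1)
}.

Inductive sf_entry : A -> Prop :=
| sf_entry_even i j : fdom m i j -> sf_entry (f i j)
| sf_entry_odd a b : phidom m a b -> sf_entry (phi a b).

End Superfrieze.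

Definition superfrieze_algebra (R : realType) (m n w : nat)
    (f phi : int -> int -> superring R m n) : superring R m n -> Prop :=
  generated (@cst R m n) (sf_entry w f phi).

(* Main.v *)
(* The bodies (coefficients of 1) of the f i j with - 1 <= j - i <= m are     *)
(* quotients of polynomials with nonnegative coefficients, hence nonzero, so  *)
(* these entries can be cancelled.  Cancellation turns the frieze rule into   *)
(* two linear relations between neighbouring diagonals, valid for             *)
(* i <= j <= i + m + 1, where e i j stands for phi_(i+1/2, j+1/2):            *)
(*     e (i+1) j = e i j - f (i+1) j * e i i,                                 *)
(*     f (i+2) j = f i i * f (i+1) j - f i j + e i i * e i j.                 *)
(* At j = i + m + 1 they give e i i and f i i in terms of the diagonals i + 1 *)
(* and i + 2, so they can be run both ways, and every entry is a polynomial   *)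
(* in the f 0 j, f 1 j and e 0 j.  Finally, mutating successively at          *)
(* x_1, ..., x_m is allowed at each step, and the exchange relation at x_k is *)
(* the even frieze rule between the diagonals 0 and 1, so that                *)
(* f 1 1, ..., f 1 m are cluster variables.                                   *)

Require Import Defs.
From HB Require Import structures.
From mathcomp Require Import all_boot all_order all_algebra.
From mathcomp Require Import fraction complex reals mpoly.
From mathcomp Require Import zify ring.

Set Implicit Arguments.
Unset Strict Implicit.
Unset Printing Implicit Defensive.

Import Order.TTheory GRing.Theory Num.Theory.

Local Open Scope ring_scope.

(** Each pair of consecutive even diagonals, with the odd diagonal in half-integer position,
    determines the whole superfrieze by polynomial formulas. So it suffices to place the diagonals 0
    and 1 in the cluster superalgebra.

    The propagation rests on [eta_next] and [f_next], whose proofs divide by entries. Division is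
    legitimate because [f_pos] makes the bodies positive fractions and [gbody_lreg] turns a nonzero
    body into left regularity. The recurrences run forwards in [diagonals_next]. They run backwards
    in [diagonals_prev], since the boundary values at the bottom let one solve for the unknown
    coefficients without dividing. [entries_in] combines both directions.

    Diagonal 0 and the odd diagonal consist of initial variables and constants. Diagonal 1 comes
    from mutating once at every vertex from left to right: [sweep_mutate] follows the extended
    quiver, [sweep_admissible] shows that the steps are allowed, and [exchange_sweep] identifies
    each exchange relation with an even frieze rule. *)

(** * Supercommutativity and bodies in the Grassmann algebra *)

Section GrassmannTheory.
Variables (K : comNzRingType) (n : nat).
Implicit Types (u v : grassmann K n) (I J S : {set 'I_n}).

(** Each pair in [I] times [J] is an inversion in exactly one of the two orders. This gives the sign
    in supercommutativity. *)
Lemma ginv_swap I J :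
  [disjoint I & J] -> (ginv I J + ginv J I = #|I| * #|J|)%N.
Proof.
move=> dIJ; rewrite /ginv [in X in (_ + X)%N]exchange_big /= -big_split /=.
rewrite -sum_nat_const; apply: eq_bigr => i iI.
rewrite -big_split /= -sum1_card; apply: eq_bigr => j jJ.
have : i != j by apply: contraTneq iI => ->; rewrite (disjointFl dIJ jJ).
by rewrite -(inj_eq val_inj) /=; case: ltngtP.
Qed.

Lemma gmulE u v S : (u * v) S =
  \sum_(I : {set 'I_n} | I \subset S)
     (-1) ^+ ginv I (S :\: I) * u I * v (S :\: I).
Proof. by rewrite [LHS]ffunE. Qed.

Lemma gmul_swapE u v S : (v * u) S =
  \sum_(I : {set 'I_n} | I \subset S) (-1) ^+ (#|I| * #|S :\: I|) *
     ((-1) ^+ ginv I (S :\: I) * u I * v (S :\: I)).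
Proof.
rewrite gmulE (reindex_onto (setD S) (setD S)) /=; last first.
  by move=> I sIS; rewrite setDDr setDv set0U; apply/setIidPr.
have DD I : I \subset S -> S :\: (S :\: I) = I.
  by move=> sIS; rewrite setDDr setDv set0U; apply/setIidPr.
apply: eq_big => [I|I /andP[_ /eqP DI]].
  rewrite subsetDl /=; apply/eqP/idP => [<-|]; [exact: subsetDl | exact: DD].
have sIS : I \subset S by rewrite -DI subsetDl.
have dI : [disjoint I & S :\: I] by rewrite -setI_eq0 setIDA setDIl setDv set0I.
rewrite DI -(ginv_swap dI) addnC exprD -!mulrA; congr (_ * _).
by rewrite [in RHS]mulrA -expr2 sqrr_sign mul1r mulrC.
Qed.

Lemma geven_comm u v : geven u -> u * v = v * u.
Proof.
move=> eu; apply/ffunP => S; rewrite [RHS]gmul_swapE gmulE.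
apply: eq_bigr => I _; case: (boolP (odd #|I|)) => [/eu ->|oI].
  by rewrite mulr0 mul0r mulr0.
by rewrite -[(-1) ^+ (_ * _)]signr_odd oddM (negPf oI) mul1r.
Qed.

Lemma godd_anticomm u v : godd u -> godd v -> u * v = - (v * u).
Proof.
move=> ou ov; apply/ffunP => S.
rewrite [RHS]ffunE (gmul_swapE u v) gmulE -sumrN.
apply: eq_bigr => I _; case: (boolP (odd #|I|)) => [oI|/ou ->]; last first.
  by rewrite mulr0 mul0r mulr0 oppr0.
case: (boolP (odd #|S :\: I|)) => [oJ|/ov ->]; last by rewrite !mulr0 oppr0.
by rewrite -[(-1) ^+ (_ * _)]signr_odd oddM oI oJ expr1 mulN1r opprK.
Qed.

Lemma gbodyM u v : (u * v) set0 = u set0 * v set0.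
Proof.
rewrite gmulE (bigD1 set0) ?sub0set //= big1 => [|I].
  by rewrite setD0 ginv0l mul1r addr0.
by rewrite subset0 andbN.
Qed.

Lemma gbody1 : (1 : grassmann K n) set0 = 1.
Proof. by rewrite [LHS]ffunE eqxx. Qed.

Lemma gbodyD u v : (u + v) set0 = u set0 + v set0.
Proof. by rewrite [LHS]ffunE. Qed.

Lemma gbodyZ (a : K) u : (a *: u) set0 = a * u set0.
Proof. by rewrite [LHS]ffunE. Qed.

Lemma godd_body u : godd u -> u set0 = 0.
Proof. by apply; rewrite cards0. Qed.

End GrassmannTheory.

(* The component of u * v at a minimal S in the support of v is the product   *)
(* of the body of u and v S.                                                  *)
Lemma gbody_lreg (K : fieldType) (n : nat) (u : grassmann K n) :
  u set0 != 0 -> GRing.lreg u.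
Proof.
move=> u0; apply: mulrI0_lreg => v uv0; apply/ffunP => S; rewrite [RHS]ffunE.
have [k] := ubnP #|S|; elim: k S => // k IHk S leSk.
have /ffunP /(_ S) := uv0; rewrite gmulE [RHS]ffunE (bigD1 set0) ?sub0set //=.
rewrite big1 => [|I /andP[sIS I0]].
  rewrite setD0 ginv0l mul1r addr0 => /eqP.
  by rewrite mulf_eq0 (negPf u0) => /eqP.
rewrite IHk ?mulr0 // -ltnS; apply: leq_trans leSk; rewrite ltnS.
by rewrite -(cardsID I S) (setIidPr sIS) addnC -addn1 leq_add2l card_gt0.
Qed.

Lemma subr_exchange (V : zmodType) (a b c d : V) :
  a - b = c - d -> a - c = b - d.
Proof.
by move/eqP; rewrite subr_eq => /eqP ->; rewrite addrAC [c - d]addrC addrK addrC.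
Qed.

Lemma le_int_ind (P : int -> Prop) (a b : int) :
  P a -> (forall j, a <= j -> j < b -> P j -> P (j + 1)) ->
  forall j, a <= j -> j <= b -> P j.
Proof.
move=> Pa IH j aj; have -> : j = a + `|j - a|%N%:Z by lia.
elim: `|j - a|%N => [|k IHk] kb; first by rewrite addr0.
rewrite (_ : a + k.+1%:Z = a + k%:Z + 1); last lia.
by apply: IH; [lia..|apply: IHk; lia].
Qed.

Lemma int_shift_ind (P : int -> Prop) : P 0 -> (forall i, P i -> P (i + 1)) ->
  (forall i, P (i + 1) -> P i) -> forall i, P i.
Proof.
move=> P0 Pn Pp; elim=> // k IHk; first by rewrite -addn1 PoszD; apply: Pn.
by apply: Pp; rewrite (_ : _ + 1 = - k%:Z) //; lia.
Qed.

(** * Recurrences between neighbouring diagonals, over a supercommutative ring *)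

Section FriezeTheory.
Variables (A : pzRingType) (even odd : A -> Prop).
Hypothesis evenC : forall u v, even u -> u * v = v * u.
Hypothesis oddC : forall u v, odd u -> odd v -> u * v = - (v * u).
Hypothesis odd_sqr : forall u, odd u -> u * u = 0.

(** Multiply by [b], eliminate [psi] by the third rule and [a * d] by the first; the extra term dies
    because [xi * xi = 0]. *)
Lemma lower_left_rule (a b c d xi psi phi sigma : A) :
  GRing.lreg b -> even a -> even b -> xi * xi = 0 ->
  a * d - b * c = 1 + sigma * xi -> b * phi - a * psi = xi ->
  b * sigma - d * xi = psi -> a * sigma - c * xi = phi.
Proof.
move=> rb ea eb xi2 r1 r2 r3; apply: rb.
have -> : b * phi = xi + a * psi by rewrite -r2 subrK.
have -> : a * psi = b * (a * sigma) - a * d * xi.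
  by rewrite -r3 mulrBr !mulrA (evenC b ea).
have -> : a * d = 1 + sigma * xi + b * c by rewrite -r1 subrK.
by rewrite !mulrDl mul1r -(mulrA sigma) xi2 mulr0 addr0 opprD addrCA addNKr
  mulrBr !mulrA.
Qed.

(** The algebra of the induction step of [f_next]: both sides are [g] times the next entry of
    diagonal [i + 2], on the left by the even frieze rule and the induction hypothesis, on the right
    by the claimed formula. *)
Lemma plucker_step (f0 fj fj1 g g1 e0 e e1 : A) :
  even g -> even g1 -> odd e0 -> odd e1 -> fj * g1 - g * fj1 = 1 + e1 * e ->
  1 + (e1 - g1 * e0) * (e - g * e0) + (f0 * g - fj + e0 * e) * g1
    = g * (f0 * g1 - fj1 + e0 * e1).
Proof.
move=> eg eg1 oe0 oe1 r.
have -> : (e1 - g1 * e0) * (e - g * e0) = e1 * e + g * (e0 * e1) - e0 * e * g1.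
  rewrite mulrBl !mulrBr mulrA -(evenC e1 eg) -(mulrA g) (oddC oe1 oe0) mulrN.
  rewrite opprK -!mulrA (mulrA e0 g) -(evenC e0 eg) -(mulrA g) odd_sqr //.
  by rewrite !mulr0 subr0 (evenC _ eg1) -mulrA.
rewrite !addrA -r !mulrDl !mulrDr mulrN mulNr [g * (f0 * _)]mulrA (evenC f0 eg).
by rewrite (AC (4*3) (1*6*(4*7)*5*2*3)) /= subrr addNr !add0r.
Qed.

Variables (m : nat) (f phi : int -> int -> A).
Implicit Types (i j : int).
Hypothesis F : superfrieze even odd m f phi.
Hypothesis f_lreg :
  forall i j, - 1 <= j - i -> j - i <= m%:Z -> GRing.lreg (f i j).

(** [eta] covers the odd entries with half-integer indices and [theta] those with integer
    indices. *)
Local Notation eta i j := (phi (2 * i + 1) (2 * j + 1)).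
Local Notation theta i j := (phi (2 * i + 2) (2 * j + 2)).

Lemma frieze_ruleE i j : - 1 <= j - i -> j - i <= m%:Z ->
  [/\ f i j * f (i + 1) (j + 1) - f (i + 1) j * f i (j + 1)
        = 1 + eta i (j + 1) * eta i j,
      f (i + 1) j * theta (i - 1) j - f i j * theta i j = eta i j
    & f (i + 1) j * eta i (j + 1) - f (i + 1) (j + 1) * eta i j = theta i j].
Proof.
move=> h1 h2; have := sf_rule F (i := i) (j := j).
rewrite /frieze_rule (_ : 2 * (j + 1) + 1 = 2 * j + 3); last lia.
rewrite (_ : 2 * (i - 1) + 2 = 2 * i); last lia.
by apply; rewrite /diamond /fdom /phidom; lia.
Qed.

Lemma fdom_even i j : - 2 <= j - i -> j - i <= m.+1%:Z -> even (f i j).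
Proof. by move=> h1 h2; apply: (sf_even F); rewrite /fdom h1. Qed.

Lemma eta_odd i j : - 1 <= j - i -> j - i <= m.+1%:Z -> odd (eta i j).
Proof. by move=> h1 h2; apply: (sf_odd F); rewrite /phidom; lia. Qed.

Lemma f_top i : f (i + 1) i = 1.
Proof. by rewrite -{2}(addrK 1 i) (sf_f_top1 F). Qed.

Lemma eta_top i : eta (i + 1) i = 0.
Proof. by rewrite -[RHS](sf_phi_top0 F (2 * i + 3)); congr phi; lia. Qed.

Lemma eta_bot i : eta i (i + m.+1%:Z) = 0.
Proof. by rewrite -[RHS](sf_phi_bot0 F (2 * i + 1)); congr phi; lia. Qed.

Lemma lower_left_eta i j : 0 <= j - i -> j - i <= m.+1%:Z ->
  f (i + 1) j * eta (i + 1) (j + 1) - f (i + 1) (j + 1) * eta (i + 1) j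
    = theta i j.
Proof.
move=> h1 h2; have [ij|/eqP ij] := eqVneq i j.
  (* On the top row the entry to cancel is 0, so the identity has to come from [sf_top]. *)
  rewrite -ij f_top mul1r eta_top mulr0 subr0.
  rewrite (_ : 2 * i + 2 = 2 * (i + 1)); last lia.
  by rewrite (sf_top F).
have [||r1 r2 r3] := @frieze_ruleE (i + 1) j; try lia.
rewrite addrK in r2; apply: (lower_left_rule _ _ _ _ r1 r2 r3).
- by apply: f_lreg; lia.
- by apply: fdom_even; lia.
- by apply: fdom_even; lia.
- by apply: odd_sqr; apply: eta_odd; lia.
Qed.

(** The third rule and [lower_left_eta] say that [eta i] and [eta (i + 1)] solve the same
    inhomogeneous first-order recurrence in [j]. Their difference solves the homogeneous one, as
    does [f (i + 1)], and [j = i] fixes the factor. *)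
Lemma eta_next i j : i <= j -> j <= i + m.+1%:Z ->
  eta (i + 1) j = eta i j - f (i + 1) j * eta i i.
Proof.
move=> ij jm; suff <- : eta i j - eta (i + 1) j = f (i + 1) j * eta i i.
  by rewrite subKr.
move: j ij jm; apply: le_int_ind => [|j ij jm IHj].
  by rewrite eta_top subr0 f_top mul1r.
have rG : GRing.lreg (f (i + 1) j) by apply: f_lreg; lia.
apply: rG; have [||_ _ r] := @frieze_ruleE i j; try lia.
have r' : _ = theta i j := @lower_left_eta i j _ _.
rewrite [RHS]mulrA (evenC (f (i + 1) (j + 1))); last by apply: fdom_even; lia.
rewrite -mulrA -IHj !mulrBr; apply: subr_exchange.
by rewrite r r' //; lia.
Qed.

Lemma f_next i j : i <= j -> j <= i + m.+1%:Z ->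
  f (i + 1 + 1) j = f i i * f (i + 1) j - f i j + eta i i * eta i j.
Proof.
move: j; apply: le_int_ind => [|j ij jm IHj].
  have -> : f (i + 1 + 1) i = 0.
    by rewrite -[RHS](sf_f_top0 F (i + 1 + 1)); congr f; lia.
  by rewrite f_top mulr1 subrr odd_sqr ?addr0 //; apply: eta_odd; lia.
have rG : GRing.lreg (f (i + 1) j) by apply: f_lreg; lia.
apply: rG; have [||r _ _] := @frieze_ruleE (i + 1) j; try lia.
have [||r0 _ _] := @frieze_ruleE i j; try lia.
move/eqP: r; rewrite subr_eq => /eqP ->.
rewrite !eta_next ?IHj; try lia.
apply: plucker_step.
- by apply: fdom_even; lia.
- by apply: fdom_even; lia.
- by apply: eta_odd; lia.
- by apply: eta_odd; lia.
- by rewrite -r0; congr (_ - _); apply: evenC; apply: fdom_even; lia.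
Qed.

(** * Propagating membership in a subring to all entries *)

Variable S : A -> Prop.
Hypotheses (S0 : S 0) (S1 : S 1).
Hypothesis SB : forall a b, S a -> S b -> S (a - b).
Hypothesis SM : forall a b, S a -> S b -> S (a * b).

Let SD a b : S a -> S b -> S (a + b).
Proof. by move=> Sa Sb; rewrite -[b]opprK -[- b]sub0r; apply/SB/SB. Qed.

Definition diagonals_in (i : int) : Prop :=
  [/\ forall j, fdom m i j -> S (f i j),
      forall j, fdom m (i + 1) j -> S (f (i + 1) j)
    & forall j, phidom m (2 * i + 1) (2 * j + 1) -> S (eta i j)].

Lemma diagonals_next i : diagonals_in i -> diagonals_in (i + 1).
Proof.
rewrite /diagonals_in /fdom /phidom => -[Sf Sg Se]; split=> // j dj.
  have [jm|jm] := lerP j (i + m.+1%:Z).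
    rewrite f_next; [apply: SD; last by apply: SM; apply: Se; lia|lia..].
    by apply: SB; [apply: SM; [apply: Sf|apply: Sg]|apply: Sf]; lia.
  have [->|->] : j = i + 1 + 1 + m%:Z \/ j = i + 1 + 1 + m.+1%:Z by lia.
    by rewrite (sf_f_bot1 F).
  by rewrite (sf_f_bot0 F).
have [jm|jm] := lerP j (i + m.+1%:Z).
  rewrite eta_next; [apply: SB; first by apply: Se; lia|lia..].
  by apply: SM; [apply: Sg|apply: Se]; lia.
have -> : j = i + 1 + m.+1%:Z by lia.
by rewrite eta_bot.
Qed.

Lemma diagonals_prev i : diagonals_in (i + 1) -> diagonals_in i.
Proof.
rewrite /diagonals_in /fdom /phidom => -[Sg Sh Sz].
have g1 : f (i + 1) (i + m.+1%:Z) = 1.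
  by rewrite -[RHS](sf_f_bot1 F (i + 1)); congr f; lia.
(* At [j = i + m + 1], where [eta i j = 0] and [f (i + 1) j = 1], [eta_next] reads
   [eta (i + 1) j = - eta i i]. *)
have See : S (eta i i).
  rewrite -[eta i i]opprK -[X in - X]sub0r -sub0r; apply: SB => //.
  rewrite -[X in S (_ - X)]mul1r -g1 -{1}(eta_bot i) -eta_next; try lia.
  by apply: Sz; lia.
have Se j : phidom m (2 * i + 1) (2 * j + 1) -> S (eta i j).
  rewrite /phidom => dj; have [ij|ij] := lerP i j; last first.
    have -> : i = j + 1 by lia.
    by rewrite eta_top.
  have -> : eta i j = eta (i + 1) j + f (i + 1) j * eta i i.
    by rewrite eta_next ?subrK //; lia.
  by apply: SD; [apply: Sz|apply: SM See; apply: Sg]; lia.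
have Sfii : S (f i i).
  (* At the same [j], [f_next] reduces to [f (i + 2) j = f i i]. *)
  have := @f_next i (i + m.+1%:Z); rewrite g1 mulr1 (sf_f_bot0 F) eta_bot.
  by rewrite mulr0 subr0 addr0 => <-; [apply: Sh|..]; lia.
split=> // j dj; have [ij|ij] := lerP i j; last first.
  have [->|->] : j = i - 2 \/ j = i - 1 by lia.
    by rewrite (sf_f_top0 F).
  by rewrite (sf_f_top1 F).
have -> : f i j = f i i * f (i + 1) j + eta i i * eta i j - f (i + 1 + 1) j.
  rewrite f_next; [|lia..].
  by rewrite opprD opprB addrACA subrr addr0 addrC subrK.
apply: SB; last by apply: Sh; lia.
by apply: SD; apply: SM => //; [apply: Sg|apply: Se; rewrite /phidom]; lia.
Qed.

Lemma entries_in : diagonals_in 0 -> forall a, sf_entry m f phi a -> S a.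
Proof.
move=> D0; have D : forall i, diagonals_in i.
  apply: int_shift_ind => // i; [exact: diagonals_next|exact: diagonals_prev].
have Se i j : phidom m (2 * i + 1) (2 * j + 1) -> S (eta i j).
  by have [_ _] := D i; apply.
move=> _ [i j ij|a b ab]; first by have [Sf _ _] := D i; apply: Sf.
have [i [j [[ea eb]|[ea eb]]]] : exists i j : int,
    (a = 2 * i + 1 /\ b = 2 * j + 1) \/ (a = 2 * i + 2 /\ b = 2 * j + 2).
- move: ab; rewrite /phidom => ab.
  exists ((a - 1) %/ 2)%Z, ((b - 1) %/ 2)%Z; lia.
- by rewrite ea eb; apply: Se; rewrite -ea -eb.
(* A [theta] entry is either on the zero bottom boundary or given by the third frieze rule. *)
rewrite ea eb; move: ab; rewrite ea eb /phidom => ab.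
have [jm|jm] := lerP j (i + m%:Z); last first.
  have -> : 2 * j + 2 = 2 * i + 2 + 2 * m.+1%:Z by lia.
  by rewrite (sf_phi_bot0 F).
have [||_ _ <-] := @frieze_ruleE i j; try lia.
have [_ Sg _] := D i.
by apply: SB; apply: SM; (apply: Sg || apply: Se); rewrite /fdom /phidom; lia.
Qed.

End FriezeTheory.

(** * Subtraction-free rational functions *)

(* Nonvanishing of the bodies of the entries is obtained from positivity:     *)
(* unlike nonvanishing, it is preserved by the subtraction-free frieze rule.  *)
Section PositiveFractions.
Variables (C : numDomainType) (m : nat).
Implicit Types (p q : {mpoly C[m]}) (x y : {fraction {mpoly C[m]}}).

Local Notation "p %:F" := (tofrac p) : ring_scope.

Definition pos_mpoly p : Prop := p <> 0 /\ forall k, 0 <= p@_k.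

Lemma pos_mpoly1 : pos_mpoly 1.
Proof.
by split=> [/eqP|k]; [rewrite oner_eq0|rewrite mcoeff1 ler0n].
Qed.

Lemma pos_mpolyD p q : pos_mpoly p -> pos_mpoly q -> pos_mpoly (p + q).
Proof.
move=> [p0 hp] [_ hq]; split=> [pq0|k]; last by rewrite mcoeffD addr_ge0.
apply: p0; apply/mpolyP => k; apply/eqP; rewrite mcoeff0.
have := congr1 (mcoeff k) pq0; rewrite mcoeffD mcoeff0 => /eqP.
by rewrite paddr_eq0 // => /andP[].
Qed.

Lemma pos_mpolyM p q : pos_mpoly p -> pos_mpoly q -> pos_mpoly (p * q).
Proof.
move=> [p0 hp] [q0 hq]; split=> [/eqP|k].
  by rewrite mulf_eq0 => /orP[] /eqP.
by rewrite mcoeffM; apply: sumr_ge0 => i _; apply: mulr_ge0.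
Qed.

Definition pos_frac x : Prop :=
  exists p q, [/\ pos_mpoly p, pos_mpoly q & x * q%:F = p%:F].

Lemma pos_mpoly_neq0 p : pos_mpoly p -> p%:F != 0.
Proof. by move=> [/eqP p0 _]; rewrite tofrac_eq0. Qed.

Lemma pos_frac_neq0 x : pos_frac x -> x != 0.
Proof.
move=> [p [q [/pos_mpoly_neq0 p0 _ e]]].
by apply: contraNneq p0 => x0; rewrite -e x0 mul0r.
Qed.

Lemma pos_fracD x y : pos_frac x -> pos_frac y -> pos_frac (x + y).
Proof.
move=> [p [q [hp hq e]]] [p' [q' [hp' hq' e']]].
exists (p * q' + p' * q), (q * q'); split.
- by apply: pos_mpolyD; apply: pos_mpolyM.
- exact: pos_mpolyM.
- by rewrite tofracD !tofracM -e -e'; ring.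
Qed.

Lemma pos_fracM x y : pos_frac x -> pos_frac y -> pos_frac (x * y).
Proof.
move=> [p [q [hp hq e]]] [p' [q' [hp' hq' e']]].
exists (p * p'), (q * q'); split; [exact: pos_mpolyM..|].
by rewrite !tofracM -e -e'; ring.
Qed.

Lemma pos_frac_mulr x y : pos_frac (x * y) -> pos_frac x -> pos_frac y.
Proof.
move=> [p [q [hp hq e]]] [p' [q' [hp' hq' e']]].
exists (p * q'), (q * p'); split; [exact: pos_mpolyM..|].
by rewrite !tofracM -e -e'; ring.
Qed.

Lemma pos_frac_tofrac p : pos_mpoly p -> pos_frac p%:F.
Proof.
by move=> hp; exists p, 1; rewrite tofrac1 mulr1; split=> //; apply: pos_mpoly1.
Qed.

Lemma pos_frac1 : pos_frac 1.
Proof.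
by rewrite -tofrac1; apply/pos_frac_tofrac/pos_mpoly1.
Qed.

Lemma pos_fracX k : pos_frac ('X_k)%:F.
Proof.
apply: pos_frac_tofrac; split=> [/(congr1 (mcoeff U_(k)))/eqP|i].
  by rewrite mcoeffX mcoeff0 eqxx oner_eq0.
by rewrite mcoeffX ler0n.
Qed.

End PositiveFractions.

(** * The mutation sequence on the extended quiver *)

Section QuiverMutation.
Variable m : nat.

(* The quiver obtained from Qtilde m by mutating at the first k vertices.     *)
Definition sweep_arr (k : nat) (i j : 'I_m) : nat :=
  ((j == i.+1 :> nat) && (j != k :> nat)) || ((i == k :> nat) && (j.+1 == k)).

Definition sweep_tpath (k : nat) (i : 'I_m.+1) (l : 'I_m) (j : 'I_m.+1) : nat :=
  if (l < k)%N
  then (j == l.+1 :> nat) &&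
    ((i == l :> nat) || ((i == l.+2 :> nat) && (l.+1 < k)%N))
  else (j == l :> nat) &&
    (((i.+1 == l :> nat) && (k < l)%N) || (i == l.+1 :> nat)).

Definition sweep_quiver (k : nat) (Q : ext_quiver m m.+1) : Prop :=
  (forall i j, arr Q i j = sweep_arr k i j) /\
  (forall i l j, tpath Q i l j = sweep_tpath k i l j).

Lemma sweep_quiver0 : sweep_quiver 0 (Qtilde m).
Proof.
split=> [i j|i l j]; rewrite /sweep_arr /sweep_tpath /=.
  by case: eqP; lia.
by congr nat_of_bool; lia.
Qed.

(** The only 2-path through [k] starts at [k + 1] and ends at [k]. Its copy at vertex [k + 1]
    cancels an existing opposite 2-path; its copy at [k - 1] survives. *)
Lemma sweep_mutate (k : 'I_m) Q :
  sweep_quiver k Q -> sweep_quiver k.+1 (mutate k Q).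
Proof.
move=> [ea et]; split=> [i j|i l j]; rewrite /= /mut_arr /mut_tpath.
  rewrite !ea /sweep_arr !mulnb -!(inj_eq val_inj) /=.
  case: (eqVneq (i : nat) k) => ik; case: (eqVneq (j : nat) k) => jk.
  - by rewrite ?ik ?jk /=; lia.
  - by rewrite ?ik ?jk /=; lia.
  - by rewrite ?ik ?jk /=; lia.
  - rewrite ?(negPf ik) ?(negPf jk) /= eqxx !andbF /= !addn0 !andbT; lia.
rewrite !et !ea /sweep_tpath /sweep_arr !ltnn -!(inj_eq val_inj) /= !mulnb.
case: (ltngtP l k) => lk /=.
- rewrite (_ : (l < k.+1)%N); last lia.
  rewrite (_ : (l == k.+1 :> nat) = false); last lia.
  rewrite eqxx /= !andbF /= ltnS lk.
  case: (eqVneq l.+1 k) => [<-|lk1].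
    rewrite ltnn !andbF !andbT !orbF. lia.
  rewrite (_ : (l.+1 < k)%N); last lia.
  rewrite !andbF !andbT !addn0. lia.
- rewrite (_ : (l < k.+1)%N = false); last lia.
  rewrite (_ : (l.+1 == k) = false); last lia.
  rewrite !andbF !orbF !andbT.
  case: (eqVneq (l : nat) k.+1) => [->|lk1].
    rewrite ltnn !andbF !andbT /= !eqSS. lia.
  rewrite (_ : (k.+1 < l)%N); last lia.
  rewrite !andbF !andbT !addn0. lia.
- rewrite lk ltnSn; lia.
Qed.

Lemma sweep_admissible (k : nat) Q : sweep_quiver k Q -> admissible Q.
Proof.
move=> [_ et] l; have l1 : (l.+1 < m.+1)%N by rewrite ltnS ltn_ord.
(* All 2-paths through [l] end at this one odd vertex, each with multiplicity one. *)
pose e : 'I_m.+1 := if (l < k)%N then Ordinal l1 else widen_ord (leqnSn m) l.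
have tE i j : (0 < tpath Q i l j)%N -> j = e /\ tpath Q i l j = 1%N.
  rewrite et /sweep_tpath => tn0; split; last by move: tn0; case: ifP; lia.
  by apply/val_inj => /=; move: tn0; rewrite /e; case: ifP => _ /=; lia.
have ends_e j : j \in ends Q l -> j = e.
  by rewrite inE; case/existsP => i /tE[].
split.
  rewrite -setI_eq0; apply/eqP/setP => j; rewrite in_setI in_set0.
  apply/negP => /andP[+ /ends_e je]; rewrite {}je inE; case/existsP => i ei.
  have [ie _] := tE _ _ ei; move: ei; rewrite {}ie et.
  by rewrite /sweep_tpath /e; case: ifP => /=; lia.
exists 1%N => i j; rewrite inE; case/existsP => i' ii' /ends_e ->.
by have [<- ->] := tE _ _ ii'.
Qed.

End QuiverMutation.

Lemma sum_delta (V : nmodType) (I J : finType) (G : I -> J -> V)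
    (d : I -> J -> nat) (i0 : I) (j0 : J) :
  (forall i j, d i j = (i == i0) && (j == j0)) ->
  \sum_i \sum_j G i j *+ d i j = G i0 j0.
Proof.
move=> dE; rewrite (bigD1 i0) //= (bigD1 j0) //= dE !eqxx.
rewrite big1 => [|j /negPf j0j].
  rewrite addr0 big1 ?addr0 // => i /negPf i0i.
  by apply: big1 => j _; rewrite dE i0i.
by rewrite dE j0j andbF.
Qed.

(** * Positivity of the frieze and its cluster variables *)

Section ClusterFrieze.
Variables (R : realType) (m : nat).
Local Notation A := (superring R m m.+1).
Local Notation body u := ((u : grassmann (ratfun R m) m.+1) set0).
Variables f phi : int -> int -> A.
Implicit Types (i j : int).
Hypothesis F : superfrieze (@superring_even R m m.+1)
  (@superring_odd R m m.+1) m f phi.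
Hypothesis f_init : forall k : 'I_m, f 0 (k : nat)%:Z = evar R m.+1 k.
Hypothesis phi_init :
  forall k : 'I_m.+1, phi 1 (2 * (k : nat)%:Z + 1) = ovar R m k.

Lemma superring_evenC (u v : A) : superring_even u -> u * v = v * u.
Proof. exact: geven_comm. Qed.

Lemma superring_oddC (u v : A) :
  superring_odd u -> superring_odd v -> u * v = - (v * u).
Proof. exact: godd_anticomm. Qed.

Lemma superring_odd_sqr (u : A) : superring_odd u -> u * u = 0.
Proof.
move=> ou; have /eqP := superring_oddC ou ou.
rewrite -subr_eq0 opprK -mulr2n -scaler_nat scaler_eq0 => /orP[|/eqP //].
have P1 := @pos_frac1 R[i] m; have /pos_frac_neq0 := pos_fracD P1 P1.
(* Here 2 is nonzero as a sum of positive fractions. *)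
by move=> /negPf; rewrite -natr1 => ->.
Qed.

Lemma body_rule i j : - 1 <= j - i -> j - i <= m%:Z ->
  body (f i j) * body (f (i + 1) (j + 1))
    = 1 + body (f (i + 1) j) * body (f i (j + 1)).
Proof.
move=> h1 h2; have [||r _ _] := @frieze_ruleE _ _ _ _ _ _ F i j => //.
move/eqP: r; rewrite subr_eq => /eqP /(congr1 (fun u : A => body u)) r.
rewrite -gbodyM; apply: etrans r _.
rewrite !gbodyD gbody1 !gbodyM [body (phi _ (2 * j + 1))]godd_body.
  by rewrite mulr0 addr0.
by apply: (eta_odd F); lia.
Qed.

(** On bodies the rule is the classical frieze rule. Diagonal 0 consists of variables and ones;
    later diagonals are filled from the top boundary, earlier ones from the bottom boundary. *)
Lemma f_pos i j : - 1 <= j - i -> j - i <= m%:Z -> pos_frac (body (f i j)).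
Proof.
have pos_top k : pos_frac (body (f k (k - 1))).
  by rewrite (sf_f_top1 F) gbody1; apply: pos_frac1.
have pos_bot k : pos_frac (body (f k (k + m%:Z))).
  by rewrite (sf_f_bot1 F) gbody1; apply: pos_frac1.
have pos_step (a b c d : ratfun R m) : a * d = 1 + b * c -> pos_frac a ->
    pos_frac b -> pos_frac c -> pos_frac d.
  move=> e pa pb pc; apply: pos_frac_mulr pa; rewrite e.
  by apply: pos_fracD; [apply: pos_frac1|apply: pos_fracM].
move: i j; apply: int_shift_ind => [j h1 h2|i IHi j h1 h2|i IHi j h1 h2].
- have [->|[->|[k jk]]] :
      j = 0 - 1 \/ j = 0 + m%:Z \/ exists k : 'I_m, j = k%:Z.
  + have [j0|j0] := ltrP j 0; first by left; lia.
    have [jm|jm] := ltnP `|j|%N m; last by right; left; lia.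
    by right; right; exists (Ordinal jm) => /=; lia.
  + exact: pos_top.
  + exact: pos_bot.
  rewrite jk f_init gbodyZ gbody1 mulr1; exact: pos_fracX.
- have [jm|jm] := ltrP j (i + 1 + m%:Z); last first.
    by have -> : j = i + 1 + m%:Z by lia.
  have : j <= i + m%:Z by lia.
  have : i <= j by lia.
  move: j {h1 h2 jm}; apply: le_int_ind => [|j ij jm IHj].
    by have := pos_top (i + 1); rewrite addrK.
  apply: pos_step; [by apply: body_rule; lia|..|exact: IHj|];
    by apply: IHi; lia.
- have [ij|ij] := lerP i j; last by have -> : j = i - 1 by lia.
  (* Going backwards, the induction is on the distance of [j] from the bottom end [i + m]. *)
  have -> : j = i + m%:Z - (i + m%:Z - j) by lia.
  have : i + m%:Z - j <= m%:Z by lia.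
  have : 0 <= i + m%:Z - j by lia.
  move: (i + m%:Z - j) => {ij h1 h2}; apply: le_int_ind => [|t t0 tm IHt].
    by rewrite subr0.
  have e : i + m%:Z - (t + 1) + 1 = i + m%:Z - t by lia.
  have := @body_rule i (i + m%:Z - (t + 1)); rewrite e mulrC => r.
  apply: pos_step; [by apply: r; lia|..|exact: IHt]; by apply: IHi; lia.
Qed.

Lemma f_lreg i j : - 1 <= j - i -> j - i <= m%:Z -> GRing.lreg (f i j).
Proof.
by move=> h1 h2; apply/gbody_lreg/pos_frac_neq0/f_pos.
Qed.

Definition sweep_seed (k l : nat) : A :=
  if (l < k)%N then f 1 (l%:Z + 1) else f 0 l%:Z.

Lemma prod_sweep (k : nat) (km : (k < m)%N) :
  \prod_(l < m) sweep_seed k l ^+ ((l == k.+1 :> nat) || (l.+1 == k))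
    = f 1 k%:Z * f 0 (k%:Z + 1).
Proof.
rewrite -(big_mkord xpredT
  (fun l => sweep_seed k l ^+ ((l == k.+1) || (l.+1 == k)))).
rewrite (big_cat_nat _ (ltnW km)) //= (big_ltn km); congr (_ * _).
  (* A missing neighbour, here at the left end and below at the right end, is replaced by a boundary
     value 1. *)
  case: k km => [|k] km; first by rewrite big_geq // -(f_top F 0) add0r.
  rewrite big_nat_recr //= big_nat big1 ?mul1r => [|l lk].
    by rewrite /sweep_seed ltnSn eqxx orbT expr1; congr f; lia.
  by rewrite (_ : _ || _ = false) //; lia.
rewrite (_ : _ || _ = false) ?mul1r; last by lia.
have [k1m|k1m] := ltnP k.+1 m; last first.
  rewrite big_geq // -(sf_f_bot1 F 0); congr f; lia.
rewrite big_ltn // eqxx expr1 big_nat big1 ?mulr1 => [|l lk].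
  by rewrite /sweep_seed ltnNge leqnSn /=; congr f; lia.
by rewrite (_ : _ || _ = false) //; lia.
Qed.

Lemma exchange_sweep (k : 'I_m) Q y : sweep_quiver k Q ->
  (forall l : 'I_m, y l = sweep_seed k l) ->
  evar R m.+1 k * f 1 (k%:Z + 1) = exchange_rhs Q y k.
Proof.
move=> [ea et] ey; rewrite /exchange_rhs.
rewrite [X in _ + _ * X]big1 ?mulr1; last first.
  move=> i _; rewrite ea /sweep_arr (_ : _ || _ = false) //; lia.
rewrite (eq_bigr (fun l : 'I_m =>
    sweep_seed k l ^+ ((l == k.+1 :> nat) || (l.+1 == k)))); last first.
  by move=> l _; rewrite ey ea /sweep_arr; congr (_ ^+ nat_of_bool _); lia.
have km := ltn_ord k; rewrite (prod_sweep km) -f_init.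
have [||r _ _] := @frieze_ruleE _ _ _ _ _ _ F 0 k%:Z; try lia.
move/eqP: r; rewrite subr_eq add0r => /eqP ->.
rewrite addrC; congr (_ + (_ + _)).
have k1 : (k.+1 < m.+1)%N by rewrite ltnS.
pose k0 : 'I_m.+1 := widen_ord (leqnSn m) k.
under eq_bigr do under eq_bigr do rewrite et.
rewrite (@sum_delta _ _ _ _ _ (Ordinal k1) k0) => [|i j].
  by rewrite -!phi_init; congr (phi _ _ * phi _ _) => /=; lia.
rewrite /sweep_tpath ltnn andbF -!(inj_eq val_inj) /=; congr nat_of_bool; lia.
Qed.

Lemma reachable_sweep k : (k <= m)%N -> exists Q y,
  [/\ reachable (Qtilde m) Q y, sweep_quiver k Q
    & forall l : 'I_m, y l = sweep_seed k l].
Proof.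
elim: k => [_|k IHk km].
  exists (Qtilde m), (evar R m.+1).
  split; [exact: reach_init|exact: sweep_quiver0|].
  by move=> l; rewrite /sweep_seed ltn0 f_init.
have [Q [y [rQ sQ ey]]] := IHk (ltnW km).
have sQ' := @sweep_mutate m (Ordinal km) Q sQ.
exists (mutate (Ordinal km) Q),
  (fun l => if l == Ordinal km then f 1 (k%:Z + 1) else y l).
split=> // [|l].
  apply: reach_mut => //; first exact: sweep_admissible sQ'.
  rewrite -(exchange_sweep (k := Ordinal km) sQ ey) ey /sweep_seed ltnn.
  by rewrite (f_init (Ordinal km)).
rewrite /sweep_seed -(inj_eq val_inj) /= ltnS leq_eqVlt ey.
by case: eqP => [->|].
Qed.

Lemma row_ind (P : A -> Prop) (i j : int) : fdom m i j -> P 0 -> P 1 ->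
  (forall k : 'I_m, P (f i (i + k%:Z))) -> P (f i j).
Proof.
rewrite /fdom => ij P0 P1 Pk; have [jm|jm] := lerP (i + m%:Z) j.
  have [->|->] : j = i + m%:Z \/ j = i + m.+1%:Z by lia.
    by rewrite (sf_f_bot1 F).
  by rewrite (sf_f_bot0 F).
have [j0|j0] := ltrP j i.
  have [->|->] : j = i - 2 \/ j = i - 1 by lia.
    by rewrite (sf_f_top0 F).
  by rewrite (sf_f_top1 F).
have km : (`|j - i| < m)%N by lia.
have := Pk (Ordinal km); rewrite (_ : i + _ = j) //=; lia.
Qed.

Lemma cluster_entries a :
  sf_entry m f phi a -> cluster_superalgebra (Qtilde m) a.
Proof.
have C0 : cluster_superalgebra (Qtilde m) (0 : A).
  have <- : cst m m.+1 0 = 0 :> A by rewrite /cst mpolyC0 tofrac0 scale0r.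
  exact: gen_scalar.
have C1 : cluster_superalgebra (Qtilde m) (1 : A).
  have <- : cst m m.+1 1 = 1 :> A by rewrite /cst mpolyC1 tofrac1 scale1r.
  exact: gen_scalar.
have CN1 : cluster_superalgebra (Qtilde m) (- 1 : A).
  have <- : cst m m.+1 (- 1) = - 1 :> A.
    by rewrite /cst mpolyCN mpolyC1 tofracN tofrac1 scaleN1r.
  exact: gen_scalar.
apply: (entries_in superring_evenC superring_oddC superring_odd_sqr F f_lreg)
  => //.
- move=> u v Cu Cv; rewrite -mulN1r; apply: gen_add => //; exact: gen_mul.
- by move=> u v Cu Cv; apply: gen_mul.
split=> j; rewrite /fdom /phidom => hj.
- apply: (row_ind (i := 0)) => // k; rewrite add0r f_init.
  by apply: gen_incl; apply: cg_even (reach_init _ _).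
- have [Q [y [rQ _ ey]]] := reachable_sweep (leqnn m).
  apply: (row_ind (i := 0 + 1)) => // k.
  have := ey k; rewrite /sweep_seed ltn_ord add0r addrC => <-.
  by apply: gen_incl; apply: cg_even rQ.
- have [jm|jm] := lerP j m%:Z; last first.
    have -> : j = 0 + m.+1%:Z by lia.
    by rewrite (eta_bot F).
  have [j0|j0] := lerP 0 j; last first.
    have -> : 2 * 0 + 1 = 2 * (j + 1) + 1 by lia.
    by rewrite (eta_top F).
  have k1 : (`|j| < m.+1)%N by lia.
  have -> : j = (Ordinal k1 : nat)%:Z by move=> /=; lia.
  by rewrite mulr0 add0r phi_init; apply/gen_incl/cg_odd.
Qed.

End ClusterFrieze.

Theorem theorem5p3 (R : realType) (m : nat) (hm : (1 <= m)%N)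
    (f phi : int -> int -> superring R m m.+1)
    (hF : superfrieze (@superring_even R m m.+1) (@superring_odd R m m.+1)
            m f phi)
    (hx : forall k : 'I_m, f 0 (k : nat)%:Z = evar R m.+1 k)
    (hxi : forall k : 'I_m.+1,
        phi 1 (2 * (k : nat)%:Z + 1) = ovar R m k) :
  (forall a : superring R m m.+1,
      sf_entry m f phi a -> cluster_superalgebra (Qtilde m) a) /\
  (forall a : superring R m m.+1,
      superfrieze_algebra m f phi a -> cluster_superalgebra (Qtilde m) a).
Proof.
have entries := cluster_entries hF hx hxi; split=> // a.
elim=> [c|b /entries //|b c _ Cb _ Cc|b c _ Cb _ Cc].
- exact: gen_scalar.
- exact: gen_add.
- exact: gen_mul.
Qed.
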